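(* For each $d\in\{2,3,4,5,6,9,11,13\}$, there exists a $d$-regular bipartite graph $G=(X,Y)$ satisfying the double Hall property with $|X|=|Y|=n=\binom d2+1$. Furthermore, for infinitely many values of $n$, there exists a $d$-regular bipartite graph $G=(X,Y)$ with $|X|=|Y|=n$ satisfying the double Hall property with $d=n^{\alpha}$, where $\alpha=\log_{79}13\approx 0.587$.
   Context: All graphs are finite and simple. A graph is $d$-regular if every vertex has degree exactly $d$. For a vertex set $S$, $\Lambda^2(S)$ denotes the set of vertices adjacent to at least two vertices of $S$. A bipartite graph $G=(X,Y)$ with $|X|\ge 2$ satisfies the double Hall property if $|\Lambda^2(S)|\ge |S|$ for every $S\subseteq X$ with $|S|\ge 2$. *)

(* Defs.v *)
From HB Require Import structures.
From mathcomp Require Import all_boot.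

Set Implicit Arguments.
Unset Strict Implicit.
Unset Printing Implicit Defensive.

Record sgraph := SGraph {
  vertex :> finType;
  adj : rel vertex;
  adj_sym : symmetric adj;
  adj_irrefl : irreflexive adj
}.

Section Graph.
Variable G : sgraph.
Implicit Types (S X Y : {set G}) (d : nat).

Definition nbr (v : G) : {set G} := [set u | adj v u].

Definition regular d := forall v : G, #|nbr v| = d.

Definition bipartition X Y :=
  [/\ X :&: Y = set0, X :|: Y = [set: G]
    & forall u v : G, adj u v ->
        (u \in X /\ v \in Y) \/ (u \in Y /\ v \in X)].

(* The set written $\Lambda^2(S)$: it ranges over all vertices of the graph. *)
Definition Lambda2 S : {set G} := [set v | 2 <= #|nbr v :&: S|].

(* For a bipartite graph $(X,Y)$ the property depends on the side $X$. *)
Definition double_Hall X :=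
  2 <= #|X| /\
  forall S, S \subset X -> 2 <= #|S| -> #|S| <= #|Lambda2 S|.

End Graph.

Arguments regular : clear implicits.
Arguments bipartition : clear implicits.
Arguments double_Hall : clear implicits.

Definition ex_regular_double_Hall (d n : nat) : Prop :=
  exists (G : sgraph) (X Y : {set G}),
    [/\ bipartition G X Y, #|X| = n, #|Y| = n, regular G d & double_Hall G X].

(* Main.v *)
Require Import Defs.
From mathcomp Require Import all_boot all_order all_algebra.
From mathcomp Require Import all_classical all_reals all_analysis.
From mathcomp Require Import ring.
(* Restores the finite-set lemmas shadowed by their homonyms in all_classical. *)
From mathcomp Require Import fintype finset.

(* The graphs with n = C(d, 2) + 1 are the incidence graphs of biplanes:
   symmetric designs in which two points lie on exactly two blocks and two
   blocks meet in exactly two points.  Such a graph has the double Hall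
   property by a rank argument in the style of Fisher's inequality.  If
   T = Lambda2 S had fewer elements than S, there would be a nonzero rational
   vector f on S orthogonal to all columns in T, and computing the squared norm
   of its image would give
     2 (sum f)^2 + sum_x (deg_T x - 2) (f x)^2 = 0.
   Hence some x in S has exactly two neighbours in T; these are then the two
   common neighbours of x with every other point of S, so |S| <= 2 <= |T|.

   The second part follows from the biplane with d = 13 and n = 79: the double
   Hall property is preserved by the tensor product of bipartite graphs, which
   multiplies both d and n, so the powers of that biplane have degree 13 ^ m on
   79 ^ m + 79 ^ m vertices. *)

Set Implicit Arguments.
Unset Strict Implicit.
Unset Printing Implicit Defensive.

Import Order.TTheory GRing.Theory Num.Theory.

(** * Incidence relations *)

Section Incidence.
Variables (X Y : finType) (e : X -> Y -> bool).

Definition Lambda2_rel (S : {set X}) : {set Y} :=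
  [set y | 1 < #|[set x in S | e x y]|].

Definition double_Hall_rel :=
  forall S : {set X}, 1 < #|S| -> #|S| <= #|Lambda2_rel S|.

Definition biregular d :=
  (forall x, #|[set y | e x y]| = d) /\ (forall y, #|[set x | e x y]| = d).

Lemma Lambda2_relP (S : {set X}) y :
  reflect (exists x x', [/\ x \in S, x' \in S, e x y, e x' y & x != x'])
          (y \in Lambda2_rel S).
Proof.
rewrite inE; apply: (iffP card_gt1P).
  move=> [x [x' []]]; rewrite !inE => /andP[xS exy] /andP[x'S ex'y] ne.
  by exists x, x'.
by move=> [x [x' [xS x'S exy ex'y ne]]]; exists x, x'; rewrite !inE xS x'S exy.
Qed.

End Incidence.

Definition ex_biregular_double_Hall_rel d n :=
  exists (X Y : finType) (e : X -> Y -> bool),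
    [/\ #|X| = n, #|Y| = n, biregular e d & double_Hall_rel e].

Section IncidenceGraph.
Variables (X Y : finType) (e : X -> Y -> bool).

Definition incidence_adj : rel (X + Y) := fun u v =>
  match u, v with
  | inl x, inr y => e x y
  | inr y, inl x => e x y
  | _, _ => false
  end.

Lemma incidence_adj_sym : symmetric incidence_adj.
Proof. by case=> [x|y] [x'|y']. Qed.

Lemma incidence_adj_irrefl : irreflexive incidence_adj.
Proof. by case. Qed.

Definition incidence_graph := SGraph incidence_adj_sym incidence_adj_irrefl.

Definition left_side : {set incidence_graph} := [set inl x | x in [set: X]].
Definition right_side : {set incidence_graph} := [set inr y | y in [set: Y]].

Lemma mem_left_side u : (u \in left_side) = if u is inl _ then true else false.
Proof. by case: u => u; apply/imsetP; [exists u | case]. Qed.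

Lemma mem_right_side u :
  (u \in right_side) = if u is inr _ then true else false.
Proof. by case: u => u; apply/imsetP; [case | exists u]. Qed.

Lemma card_left_side : #|left_side| = #|X|.
Proof. by rewrite card_imset ?cardsT //; apply: inl_inj. Qed.

Lemma card_right_side : #|right_side| = #|Y|.
Proof. by rewrite card_imset ?cardsT //; apply: inr_inj. Qed.

Lemma incidence_bipartition : bipartition incidence_graph left_side right_side.
Proof.
split.
- by apply/setP=> -[u|u]; rewrite in_setI mem_left_side mem_right_side inE.
- by apply/setP=> -[u|u]; rewrite in_setU mem_left_side mem_right_side inE.
by case=> [x|y] [x'|y'] // _; rewrite !mem_left_side !mem_right_side;
  [left | right].
Qed.

Lemma incidence_regular d : biregular e d -> Defs.regular incidence_graph d.
Proof.
case=> degX degY [x|y].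
  rewrite -(degX x) -(card_imset _ (@inr_inj X Y)); congr #|pred_of_set _|.
  apply/setP=> -[u|u]; rewrite inE /=; last first.
    by rewrite mem_imset ?inE //; apply: inr_inj.
  by apply/esym/imsetP=> -[].
rewrite -(degY y) -(card_imset _ (@inl_inj X Y)); congr #|pred_of_set _|.
apply/setP=> -[u|u]; rewrite inE /=.
  by rewrite mem_imset ?inE //; apply: inl_inj.
by apply/esym/imsetP=> -[].
Qed.

Lemma incidence_double_Hall :
  1 < #|X| -> double_Hall_rel e -> double_Hall incidence_graph left_side.
Proof.
move=> X2 eH; split; first by rewrite card_left_side.
move=> S /subsetP sSX S2.
pose S' := [set x | inl x \in S].
have defS : S = inl @: S'.
  apply/setP=> u; apply/idP/imsetP; last by case=> x; rewrite inE => ? ->.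
  move=> uS; have := sSX _ uS; rewrite mem_left_side.
  by case: u uS => // x xS _; exists x; rewrite ?inE.
have cS : #|S| = #|S'| by rewrite defS card_imset //; apply: inl_inj.
rewrite cS in S2 *; apply: leq_trans (eH _ S2) _.
rewrite -(card_imset _ (@inr_inj X Y)); apply/subset_leq_card/subsetP => z.
case/imsetP=> y /Lambda2_relP [x [x' [xS x'S exy ex'y ne]]] ->.
rewrite inE; apply/card_gt1P; exists (inl x), (inl x').
by move: xS x'S; rewrite !inE /= exy ex'y => -> ->; split=> //;
  rewrite (inj_eq inl_inj).
Qed.

End IncidenceGraph.

Lemma ex_regular_double_Hall_rel d n : 1 < n ->
  ex_biregular_double_Hall_rel d n -> ex_regular_double_Hall d n.
Proof.
move=> n2 [X [Y [e [cX cY reg_e eH]]]].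
exists (incidence_graph e), (left_side e), (right_side e); split.
- exact: incidence_bipartition.
- by rewrite card_left_side.
- by rewrite card_right_side.
- exact: incidence_regular.
by apply: incidence_double_Hall; rewrite ?cX.
Qed.

(** * Tensor products *)

Section Tensor.
Variables (X1 Y1 X2 Y2 : finType).
Variables (e1 : X1 -> Y1 -> bool) (e2 : X2 -> Y2 -> bool).

Definition tensor_rel (x : X1 * X2) (y : Y1 * Y2) := e1 x.1 y.1 && e2 x.2 y.2.

Lemma tensor_biregular d1 d2 :
  biregular e1 d1 -> biregular e2 d2 -> biregular tensor_rel (d1 * d2).
Proof.
case=> r1 c1 [r2 c2]; split=> [[x1 x2]|[y1 y2]].
  rewrite -(r1 x1) -(r2 x2) -cardsX; congr #|pred_of_set _|.
  by apply/setP=> -[y1 y2]; rewrite !inE.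
rewrite -(c1 y1) -(c2 y2) -cardsX; congr #|pred_of_set _|.
by apply/setP=> -[x1 x2]; rewrite !inE.
Qed.

Lemma card_set_sum (T : finType) (A : {pred T}) : #|A| = \sum_x (x \in A).
Proof. by rewrite -sum1_card big_mkcond; apply: eq_bigr => x _; case: ifP. Qed.

Lemma card_fibersl (T1 T2 : finType) (A : {set T1 * T2}) :
  #|A| = \sum_x1 #|[set x2 | (x1, x2) \in A]|.
Proof.
rewrite card_set_sum (eq_bigr (fun p => ((p.1, p.2) \in A : nat))); last by case.
rewrite -(pair_bigA _ (fun x1 x2 => nat_of_bool ((x1, x2) \in A))).
by apply: eq_bigr => x1 _; rewrite card_set_sum; apply: eq_bigr => x2 _; rewrite inE.
Qed.

Lemma card_fibersr (T1 T2 : finType) (A : {set T1 * T2}) :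
  #|A| = \sum_x2 #|[set x1 | (x1, x2) \in A]|.
Proof.
rewrite card_set_sum (eq_bigr (fun p => ((p.1, p.2) \in A : nat))); last by case.
rewrite -(pair_bigA _ (fun x1 x2 => nat_of_bool ((x1, x2) \in A))).
rewrite exchange_big /=.
by apply: eq_bigr => x1 _; rewrite card_set_sum; apply: eq_bigr => x2 _; rewrite inE.
Qed.

Hypothesis deg1 : forall x, 0 < #|[set y | e1 x y]|.
Hypothesis deg2 : forall x, 0 < #|[set y | e2 x y]|.
Hypothesis dH1 : double_Hall_rel e1.
Hypothesis dH2 : double_Hall_rel e2.

Section TensorHall.
Variable S : {set X1 * X2}.
Hypothesis S2 : 1 < #|S|.

Let T := Lambda2_rel tensor_rel S.
Let shadow y2 := [set x1 | [exists x2, ((x1, x2) \in S) && e2 x2 y2]].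
Let good y2 := 1 < #|[set p in S | e2 p.2 y2]|.

Let goodP y2 p q : p \in S -> q \in S -> e2 p.2 y2 -> e2 q.2 y2 -> p != q ->
  good y2.
Proof.
by move=> pS qS ep eq ne; apply/card_gt1P; exists p, q; rewrite !inE pS qS ep.
Qed.

Let shadowP y2 x1 x2 : (x1, x2) \in S -> e2 x2 y2 -> x1 \in shadow y2.
Proof. by move=> xS ex; rewrite inE; apply/existsP; exists x2; rewrite xS. Qed.

(** If the shadow has two points, the double Hall property of [e1] applies to it, and its witnesses
    lift to distinct points of [S]. Otherwise two points of [S] that make [y2] good share their
    first coordinate, and any neighbour of that coordinate gives an element of [T]. *)
Lemma tensor_shadow_le y2 :
  good y2 -> #|shadow y2| <= #|[set y1 | (y1, y2) \in T]|.
Proof.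
move=> gy; case: (ltnP 1 #|shadow y2|) => [sh2 | sh1].
  apply: leq_trans (dH1 sh2) _; apply/subset_leq_card/subsetP => y1.
  case/Lambda2_relP=> x1 [x1' [+ + e1x e1x' ne]].
  rewrite [x1 \in _]inE [x1' \in _]inE [y1 \in _]inE => /existsP[x2 /andP[xS ex]] /existsP[x2' /andP[x'S ex']].
  apply/Lambda2_relP; exists (x1, x2), (x1', x2').
  rewrite /tensor_rel /= e1x e1x'.
  by split=> //; apply: contraNneq ne => -[->].
apply: (leq_trans sh1).
case/card_gt1P: gy => -[p1 p2] [[q1 q2] []]; rewrite !inE /=.
move=> /andP[pS ep] /andP[qS eq] ne.
have /card_gt0P [y1] := deg1 p1; rewrite inE => e1p.
have epq : p1 = q1.
  by move/card_le1_eqP: sh1; apply;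
    [apply: shadowP qS eq | apply: shadowP pS ep].
apply/card_gt0P; exists y1; rewrite inE; apply/Lambda2_relP.
rewrite -epq in qS ne *.
by exists (p1, p2), (p1, q2); rewrite /tensor_rel /= e1p.
Qed.

(** For a fibre with two points, the double Hall property of [e2] applies, and every [y2] it yields
    is good. For a single point, one good [y2] suffices: a common neighbour of its second coordinate
    and that of another point of [S]. *)
Lemma tensor_fiber_le x1 :
  #|[set x2 | (x1, x2) \in S]| <= #|[set y2 | good y2 && (x1 \in shadow y2)]|.
Proof.
case: (ltnP 1 #|[set x2 | (x1, x2) \in S]|) => [f2 | f1].
  apply: leq_trans (dH2 f2) _; apply/subset_leq_card/subsetP => y2.
  case/Lambda2_relP=> x2 [x2' [+ + ex ex' ne]].
  rewrite [x2 \in _]inE [x2' \in _]inE [y2 \in _]inE => xS x'S.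
  rewrite (goodP xS x'S) ?(shadowP xS) //.
  by apply: contraNneq ne => -[->].
case: (posnP #|[set x2 | (x1, x2) \in S]|) => [->//|/card_gt0P [x2]].
rewrite inE => xS; apply: leq_trans f1 _.
have [[z1 z2] zS zx] : exists2 z, z \in S & (x1, x2) != z.
  case/card_gt1P: S2 => p [q [pS qS pq]].
  case: (eqVneq (x1, x2) p) => [xp | ]; last by exists p.
  by exists q => //; rewrite xp.
suff [y2 ex ez] : exists2 y2, e2 x2 y2 & e2 z2 y2.
  apply/card_gt0P; exists y2; rewrite inE (shadowP xS ex) andbT.
  exact: (goodP xS zS).
case: (eqVneq x2 z2) => [<-|xz].
  by have /card_gt0P [y2] := deg2 x2; rewrite inE; exists y2.
(* Applied to a pair, the double Hall property yields a common neighbour. *)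
have : 1 < #|[set x2; z2]| by rewrite cards2 xz.
move=> c2; have /card_gt0P [y2] := ltnW (leq_trans c2 (dH2 c2)).
case/Lambda2_relP=> a [b []]; rewrite !inE => ha hb ea eb ab; exists y2.
  by case/orP: ha ea hb ab => /eqP-> // _ /orP[]/eqP eqb; rewrite -?eqb // eqb eqxx.
by case/orP: ha ea hb ab => /eqP-> // _ /orP[]/eqP eqb; rewrite -?eqb // eqb eqxx.
Qed.

(** Double counting of the pairs [(x1, y2)] with [y2] good and [x1] in [shadow y2]: summed over [x1]
    they bound [#|S|] from above, summed over [y2] they bound [#|T|] from below. *)
Lemma tensor_Lambda2_le : #|S| <= #|T|.
Proof.
rewrite card_fibersl.
apply: (@leq_trans (\sum_x1 \sum_(y2 | good y2) (x1 \in shadow y2))).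
  apply: leq_sum => x1 _; apply: leq_trans (tensor_fiber_le x1) _.
  rewrite card_set_sum [leqRHS]big_mkcond /=.
  by apply: leq_sum => y2 _; rewrite [y2 \in _]inE; case: (good y2).
rewrite exchange_big /= card_fibersr [leqRHS](bigID good) /=.
apply: leq_trans (leq_addr _ _); apply: leq_sum => y2 gy.
by rewrite -card_set_sum; apply: tensor_shadow_le.
Qed.

End TensorHall.

Lemma tensor_double_Hall : double_Hall_rel tensor_rel.
Proof. by move=> S S2; apply: tensor_Lambda2_le. Qed.

End Tensor.

Lemma ex_rel_tensor d1 n1 d2 n2 : 0 < d1 -> 0 < d2 ->
  ex_biregular_double_Hall_rel d1 n1 -> ex_biregular_double_Hall_rel d2 n2 ->
  ex_biregular_double_Hall_rel (d1 * d2) (n1 * n2).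
Proof.
move=> d1_gt0 d2_gt0 [X1 [Y1 [e1 [cX1 cY1 r1 h1]]]] [X2 [Y2 [e2 [cX2 cY2 r2 h2]]]].
exists (X1 * X2)%type, (Y1 * Y2)%type, (tensor_rel e1 e2); split.
- by rewrite card_prod cX1 cX2.
- by rewrite card_prod cY1 cY2.
- exact: tensor_biregular.
by apply: tensor_double_Hall => // x; rewrite ?r1.1 ?r2.1.
Qed.

Lemma ex_rel_tensor_power d n m : 0 < d ->
  ex_biregular_double_Hall_rel d n ->
  ex_biregular_double_Hall_rel (d ^ m.+1) (n ^ m.+1).
Proof.
move=> d_gt0 ex1; elim: m => [|m IHm]; first by rewrite !expn1.
by rewrite (expnS d) (expnS n); apply: ex_rel_tensor => //; rewrite expn_gt0 d_gt0.
Qed.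

(** * Biplanes *)

(** A matrix with more rows than columns has a nonzero vector in its left kernel. *)
Lemma ex_orthogonal_weights (X Y : finType) (g : X -> Y -> rat)
    (S : {set X}) (T : {set Y}) : #|T| < #|S| ->
  exists f : X -> rat,
    (exists2 x, x \in S & f x != 0%R) /\
    forall y, y \in T -> (\sum_(x in S) f x * g x y = 0)%R.
Proof.
move=> ltTS.
have [x0 x0S] : exists x, x \in S by apply/card_gt0P; apply: leq_ltn_trans ltTS.
pose A : 'M[rat]_(#|S|, #|T|) := (\matrix_(i, j) g (enum_val i) (enum_val j))%R.
have : kermx A != 0%R.
  rewrite kermx_eq0 /row_free; apply: contraTneq ltTS => rkA.
  by rewrite -leqNgt -rkA rank_leq_col.
case/rowV0Pn=> v /sub_kermxP vA /rV0Pn [i vi].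
exists (fun x => v ord0 (enum_rank_in x0S x)); split.
  by exists (enum_val i); rewrite ?enum_valP // enum_valK_in.
move=> y yT; move/matrixP/(_ ord0 (enum_rank_in yT y)): vA.
rewrite !mxE => vA; rewrite big_enum_val -[RHS]vA.
by apply: eq_bigr => j _; rewrite mxE enum_valK_in enum_rankK_in.
Qed.

Lemma biplane_double_Hall (X Y : finType) (e : X -> Y -> bool) :
  (forall x x', x != x' -> #|[set y | e x y && e x' y]| = 2) ->
  (forall y y', y != y' -> #|[set x | e x y && e x y']| = 2) ->
  double_Hall_rel e.
Proof.
move=> eX eY S S2; rewrite leqNgt; apply/negP => ltTS.
have TP := @Lambda2_relP _ _ e S.
move: (Lambda2_rel e S) ltTS TP => T ltTS TP.
(* By [TP], [T] contains all common neighbours of two distinct points of [S], so [N] loses none of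
   them; [#|N x x|] is the degree of [x] into [T]. *)
pose N x x' := [set y in T | e x y && e x' y].
have NE x x' : x \in S -> x' \in S -> x != x' -> #|N x x'| = 2.
  move=> xS x'S ne; rewrite -(eX x x' ne); congr #|pred_of_set _|.
  apply/setP=> y; rewrite !inE; apply: andb_idl => /andP[ex ex'].
  by apply/TP; exists x, x'.
have sN x x' : N x x' \subset N x x.
  by apply/subsetP=> y; rewrite !inE andbb => /and3P[-> ->].
have deg_ge2 x : x \in S -> 2 <= #|N x x|.
  move=> xS; have [x' x'S ne] : exists2 x', x' \in S & x != x'.
    case/card_gt1P: S2 => p [q [pS qS pq]].
    case: (eqVneq x p) => [-> | ]; last by exists p.
    by exists q.
  by rewrite -(NE x x') // subset_leq_card.
have [f [[a aS fa] fT]] := ex_orthogonal_weights (fun x y => (e x y)%:R%R) ltTS.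
(* After expansion, [x] and [x'] contribute [f x * f x' * #|N x x'|]. Off the diagonal the count is
   2; on it, the excess over 2 forms the last sum, where [deg_ge2] rules out truncation. *)
have quad : (\sum_(y in T) (\sum_(x in S) f x * (e x y)%:R) ^+ 2 =
   2 * (\sum_(x in S) f x) ^+ 2 + \sum_(x in S) f x ^+ 2 * (#|N x x| - 2)%:R)%R.
  under eq_bigr => y _ do rewrite expr2 big_distrlr /=.
  rewrite exchange_big expr2 big_distrlr /= mulr_sumr -big_split /=.
  apply: eq_bigr => x xS; rewrite exchange_big mulr_sumr /=.
  have NR x' : (\sum_(y in T) f x * (e x y)%:R * (f x' * (e x' y)%:R) =
               f x * f x' * #|N x x'|%:R)%R.
    rewrite -sum1_card natr_sum mulr_sumr [LHS]big_mkcond [RHS]big_mkcond /=.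
    apply: eq_bigr => y _; rewrite inE; case: (y \in T) => //=.
    by case: (e x y); case: (e x' y); rewrite /= ?mulr0 ?mul0r ?mulr1.
  under eq_bigr => x' _ do rewrite NR.
  rewrite (bigD1 x) // [in RHS](bigD1 x) //= (eq_bigr (fun x' => 2 * (f x * f x'))%R).
    by rewrite natrB ?deg_ge2 //; ring.
  by move=> x' /andP[x'S ne]; rewrite NE // 1?eq_sym // mulrC.
have degN x : x \in S -> (0 <= f x ^+ 2 * (#|N x x| - 2)%:R :> rat)%R.
  by move=> _; rewrite mulr_ge0 ?sqr_ge0 ?ler0n.
have Na : #|N a a| = 2.
  apply/eqP; rewrite eqn_leq deg_ge2 // andbT -subn_eq0.
  move: quad; rewrite big1 => [|y yT]; last by rewrite fT // expr0n.
  move/esym/eqP; rewrite paddr_eq0 ?sumr_ge0 //; last first.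
    by rewrite mulr_ge0 ?sqr_ge0.
  case/andP=> _ /eqP/psumr_eq0P-/(_ degN a aS)/eqP.
  by rewrite mulf_eq0 sqrf_eq0 (negPf fa) /= pnatr_eq0.
have /card_gt1P [y1 [y2 [y1N y2N ne]]] : 1 < #|N a a| by rewrite Na.
have T2 : 1 < #|T|.
  by apply/card_gt1P; exists y1, y2; move: y1N y2N;
    rewrite !inE => /andP[-> _] /andP[-> _].
suff : #|S| <= 2 by rewrite leqNgt (leq_ltn_trans T2).
rewrite -(eY _ _ ne); apply/subset_leq_card/subsetP => b bS; rewrite inE.
(* Both sets have two elements and one contains the other, so every [b] in [S] is adjacent to both
   [y1] and [y2]. *)
have defN : N a b = N a a.
  case: (eqVneq a b) => [<- // | ab].
  by apply/eqP; rewrite eqEcard sN Na NE.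
by move: y1N y2N; rewrite -defN !inE => /and3P[_ _ ->] /and3P[_ _ ->].
Qed.

(** * Certifying biplanes by computation on boolean matrices *)

Definition common (r s : seq bool) := count (fun p => p.1 && p.2) (zip r s).

Definition transpose v (M : seq (seq bool)) :=
  [seq [seq nth false r j | r <- M] | j <- iota 0 v].

(** [common r r] is the weight of the row [r]. Each unordered pair of rows is tested only once. *)
Definition biplane_rows v k (M : seq (seq bool)) :=
  all (fun r => (size r == v) && (common r r == k)) M &&
  pairwise (fun r s => common r s == 2) M.

Definition biplane_matrix v k M :=
  [&& size M == v, biplane_rows v k M & biplane_rows v k (transpose v M)].

Definition matrix_rel v (M : seq (seq bool)) (i j : 'I_v) :=
  nth false (nth [::] M i) j.

Lemma card_common v r s : size r = v -> size s = v ->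
  #|[set j : 'I_v | nth false r j && nth false s j]| = common r s.
Proof.
move=> sr ss; rewrite /common -sum1_count (big_nth (false, false)).
rewrite size_zip sr ss minnn big_mkord -sum1_card; apply: eq_bigl => j.
by rewrite inE nth_zip ?sr ?ss.
Qed.

Lemma biplane_rowsP v k M : size M = v -> biplane_rows v k M ->
  (forall i : 'I_v, #|[set j : 'I_v | matrix_rel M i j]| = k) /\
  (forall i i' : 'I_v, i != i' ->
     #|[set j : 'I_v | matrix_rel M i j && matrix_rel M i' j]| = 2).
Proof.
move=> sM /andP[/(all_nthP [::]) rowM /(pairwiseP [::]) pairM].
have rM (i : 'I_v) : size (nth [::] M i) = v /\
    common (nth [::] M i) (nth [::] M i) = k.
  by have [|/eqP ? /eqP] := andP (rowM i _); rewrite ?sM.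
split=> [i | ].
  have [si <-] := rM i; rewrite -(@card_common v) //; congr #|pred_of_set _|.
  by apply/setP=> j; rewrite !inE andbb.
suff H (i i' : 'I_v) : i < i' ->
    #|[set j : 'I_v | matrix_rel M i j && matrix_rel M i' j]| = 2.
  move=> i i'; rewrite -val_eqE neq_ltn => /orP[|] lt; first exact: H.
  by rewrite -(H _ _ lt); congr #|pred_of_set _|; apply/setP=> j; rewrite !inE andbC.
move=> lt; have [si _] := rM i; have [si' _] := rM i'.
by rewrite card_common //; apply/eqP/pairM => //; rewrite inE sM.
Qed.

Lemma matrix_rel_transpose v M (i j : 'I_v) : size M = v ->
  matrix_rel (transpose v M) j i = matrix_rel M i j.
Proof.
move=> sM; rewrite /matrix_rel (nth_map 0) ?size_iota // nth_iota // add0n.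
by rewrite (nth_map [::]) // sM.
Qed.

Lemma ex_rel_of_biplane_matrix v k M : biplane_matrix v k M ->
  ex_biregular_double_Hall_rel k v.
Proof.
case/and3P=> /eqP sM rM cM.
have [rk r2] := biplane_rowsP sM rM.
have [|ck c2] := biplane_rowsP _ cM; first by rewrite size_map size_iota.
exists 'I_v, 'I_v, (@matrix_rel v M); rewrite card_ord; split=> //.
  split=> // j; rewrite -(ck j); congr #|pred_of_set _|.
  by apply/setP=> i; rewrite !inE matrix_rel_transpose.
apply: biplane_double_Hall => // j j' ne; rewrite -(c2 _ _ ne).
by congr #|pred_of_set _|; apply/setP=> i; rewrite !inE !matrix_rel_transpose.
Qed.

(* Quasi-cyclic designs: the points below [q * m] are split into [q] consecutive
   copies of Z/m, on each of which [cyclic_shift] acts by translation, and the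
   remaining points are fixed. *)
Definition cyclic_shift q m i p :=
  if p < q * m then p %/ m * m + (p %% m + i) %% m else p.

Definition develop m (bases fixed : seq (seq nat)) : seq (seq nat) :=
  [seq [seq cyclic_shift (size bases) m i p | p <- b]
    | b <- bases, i <- iota 0 m] ++ fixed.

Definition incidence_matrix v (blocks : seq (seq nat)) : seq (seq bool) :=
  [seq [seq p \in b | p <- iota 0 v] | b <- blocks].

Lemma ex_rel_develop v k m bases fixed :
  biplane_matrix v k (incidence_matrix v (develop m bases fixed)) ->
  ex_biregular_double_Hall_rel k v.
Proof. exact: ex_rel_of_biplane_matrix. Qed.

(** * Explicit biplanes *)

Lemma biplane2 : ex_biregular_double_Hall_rel 2 2.
Proof.
pose bases :=
  [:: [:: 0; 1]].
apply: (@ex_rel_develop _ _ 2 bases [::]).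
by vm_compute.
Qed.

(** The blocks are the complements of single points. *)
Lemma biplane3 : ex_biregular_double_Hall_rel 3 4.
Proof.
pose bases :=
  [:: [:: 0; 1; 2]].
apply: (@ex_rel_develop _ _ 4 bases [::]).
by vm_compute.
Qed.

(** The base block is the complement of the nonzero squares modulo 7, so this is the complement of
    the Fano plane. *)
Lemma biplane4 : ex_biregular_double_Hall_rel 4 7.
Proof.
pose bases :=
  [:: [:: 0; 3; 5; 6]].
apply: (@ex_rel_develop _ _ 7 bases [::]).
by vm_compute.
Qed.

(** The base block is the Paley difference set of nonzero squares modulo 11. *)
Lemma biplane5 : ex_biregular_double_Hall_rel 5 11.
Proof.
pose bases :=
  [:: [:: 1; 3; 4; 5; 9]].
apply: (@ex_rel_develop _ _ 11 bases [::]).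
by vm_compute.
Qed.

(* The base block is a difference set in Z/2 x Z/8. *)
Lemma biplane6 : ex_biregular_double_Hall_rel 6 16.
Proof.
pose bases :=
  [:: [:: 0; 1; 2; 4; 9; 14];
     [:: 1; 6; 8; 9; 10; 12]].
apply: (@ex_rel_develop _ _ 8 bases [::]).
by vm_compute.
Qed.

(* The base block is the group of fourth powers modulo 37. *)
Lemma biplane9 : ex_biregular_double_Hall_rel 9 37.
Proof.
pose bases :=
  [:: [:: 1; 7; 9; 10; 12; 16; 26; 33; 34]].
apply: (@ex_rel_develop _ _ 37 bases [::]).
by vm_compute.
Qed.

(* The blocks are the closed neighbourhoods of the Gewirtz graph: its vertices
   are the 56 hyperovals of PG(2, 4) in one orbit of PSL(3, 4), adjacent when
   disjoint, and the shift is the cube of a Singer cycle. *)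
Lemma biplane11 : ex_biregular_double_Hall_rel 11 56.
Proof.
pose bases :=
  [:: [:: 0; 2; 5; 11; 12; 16; 20; 32; 38; 39; 52];
     [:: 2; 3; 7; 10; 11; 22; 27; 29; 43; 48; 53];
     [:: 1; 5; 14; 15; 20; 23; 27; 29; 45; 47; 54];
     [:: 8; 13; 15; 19; 21; 22; 27; 32; 36; 39; 50];
     [:: 3; 13; 20; 24; 28; 38; 48; 49; 50; 51; 54];
     [:: 3; 4; 24; 27; 32; 35; 37; 40; 46; 47; 52];
     [:: 8; 13; 16; 18; 29; 37; 38; 42; 45; 46; 53];
     [:: 4; 10; 16; 27; 28; 30; 33; 34; 39; 45; 49]].
apply: (@ex_rel_develop _ _ 7 bases [::]).
by vm_compute.
Qed.

(* A biplane of the kind found by Aschbacher, with a Frobenius group of order 55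
   of automorphisms: with the point 11 i + r written (i, r) for i < 7, the last
   five base blocks are permuted by the automorphism (i, r) |-> (i', 3 r), where
   i' = i + 1 mod 5 for i < 5 and i' = i for i = 5, 6. *)
Lemma biplane13 : ex_biregular_double_Hall_rel 13 79.
Proof.
pose bases :=
  [:: [:: 0; 1; 11; 14; 22; 31; 33; 38; 44; 48; 55; 66; 77];
     [:: 2; 10; 17; 19; 24; 29; 39; 43; 51; 52; 55; 66; 78];
     [:: 3; 5; 9; 10; 15; 17; 33; 34; 44; 57; 65; 71; 74];
     [:: 0; 15; 16; 19; 20; 23; 29; 44; 47; 61; 63; 68; 70];
     [:: 0; 9; 11; 23; 24; 26; 27; 36; 43; 57; 62; 67; 72];
     [:: 11; 16; 22; 34; 36; 37; 39; 52; 53; 61; 65; 69; 73];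
     [:: 2; 5; 22; 26; 33; 45; 47; 51; 53; 62; 63; 75; 76]].
pose fixed :=
  [:: [:: 55; 56; 57; 58; 59; 60; 61; 62; 63; 64; 65; 77; 78];
     [:: 66; 67; 68; 69; 70; 71; 72; 73; 74; 75; 76; 77; 78]].
apply: (@ex_rel_develop _ _ 11 bases fixed).
by vm_compute.
Qed.

(** * The exponent, and the conclusion *)

Lemma powR_log_ratio (R : realType) (a b m : nat) : 0 < a -> 1 < b ->
  ((a ^ m)%:R = (b ^ m)%:R `^ (ln a%:R / ln b%:R) :> R)%R.
Proof.
move=> a_gt0 b_gt1; have b_gt0 := ltnW b_gt1.
have lnb : ln (b%:R : R)%R != 0%R by rewrite gt_eqF // ln_gt0 // ltr1n.
rewrite /powR pnatr_eq0 expn_eq0 eqn0Ngt b_gt0 /= !natrX lnXn ?ltr0n //.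
rewrite mulrnAr divfK // -lnXn ?ltr0n //.
by rewrite lnK // posrE exprn_gt0 ?ltr0n.
Qed.

Theorem theorem1p11 (R : realType) :
  (forall d : nat, d \in [:: 2; 3; 4; 5; 6; 9; 11; 13] ->
     ex_regular_double_Hall d ('C(d, 2) + 1)) /\
  infinite_set [set n : nat | exists d : nat,
     (d%:R = n%:R `^ (ln 13 / ln 79) :> R)%R /\
     ex_regular_double_Hall d n]%classic.
Proof.
split=> [d|].
  rewrite !inE.
  (* In each case the explicit size is convertible to ['C(d, 2) + 1], and [isT] proves that it
     exceeds 1. *)
  case/orP=> [/eqP->|].
    exact: (@ex_regular_double_Hall_rel _ 2 isT biplane2).
  case/orP=> [/eqP->|].
    exact: (@ex_regular_double_Hall_rel _ 4 isT biplane3).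
  case/orP=> [/eqP->|].
    exact: (@ex_regular_double_Hall_rel _ 7 isT biplane4).
  case/orP=> [/eqP->|].
    exact: (@ex_regular_double_Hall_rel _ 11 isT biplane5).
  case/orP=> [/eqP->|].
    exact: (@ex_regular_double_Hall_rel _ 16 isT biplane6).
  case/orP=> [/eqP->|].
    exact: (@ex_regular_double_Hall_rel _ 37 isT biplane9).
  case/orP=> [/eqP->|].
    exact: (@ex_regular_double_Hall_rel _ 56 isT biplane11).
  by move/eqP->; exact: (@ex_regular_double_Hall_rel _ 79 isT biplane13).
(* If the set were finite, so would be its image under [(trunc_log 79 n).-1], which contains every
   [m] as the image of [79 ^ m.+1]. Exponents start at 1 because [79 ^ 0] would leave a single
   vertex on each side. *)
move=> fin; apply: infinite_nat.
apply: sub_finite_set (finite_image (fun n => (trunc_log 79 n).-1) fin) => m _.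
exists (79 ^ m.+1); last by rewrite trunc_expnK.
exists (13 ^ m.+1); split; first exact: powR_log_ratio.
apply: ex_regular_double_Hall_rel; first by rewrite -[1]/(79 ^ 0) ltn_exp2l.
exact: (ex_rel_tensor_power _ _ biplane13).
Qed.
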